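(* Let $G$ be a group, let $\rho\colon G\to\mathrm{Pos}(C_\rho)$ and $\sigma\colon G\to\mathrm{Pos}(C_\sigma)$ be representations of $G$ on closed convex cones $C_\rho\subseteq V_\rho$, $C_\sigma\subseteq V_\sigma$ in finite-dimensional real vector spaces, with $C_\sigma$ sharp, and let $X\subseteq V_\rho$ be a subspace that intersects the interior of $C_\rho$. Then for a map $\Psi\in\mathrm{Pos}(X\cap C_\rho,C_\sigma)\subseteq\mathrm{Lin}(X,V_\sigma)$ to extend to some $\Phi\in\mathrm{Pos}(C_\rho,C_\sigma)$ that intertwines $\rho$ and $\sigma$, it is necessary and sufficient that $\Psi\otimes\mathrm{id}_{V_\sigma'}$ maps $A(\rho\otimes\sigma^* )\cap(X\otimes V_\sigma')$ to $A(\sigma\otimes\sigma^* )$.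
   Context: $V'=\mathrm{Lin}(V,\mathbb R)$. For convex cones $C\subseteq V$, $D\subseteq W$: $\mathrm{Pos}(C,D)=\{\Phi\in\mathrm{Lin}(V,W)\mid\Phi(C)\subseteq D\}$, $\mathrm{Pos}(C)=\mathrm{Pos}(C,C)$, $C^\vee=\{\varphi\in V'\mid\varphi(x)\ge 0\ \forall x\in C\}$, $C\mathbin{\underline{\otimes}}D=\{\sum_i c_i\otimes d_i\mid c_i\in C,d_i\in D\}$ (finite sums). A cone $C$ is sharp if $C\cap -C=\{0\}$. $X\cap C_\rho$ is regarded as a cone in $X$. A representation of $G$ on a cone is a triple $(\rho,C_\rho,V_\rho)$ (denoted $\rho$) with $C_\rho\subseteq V_\rho$ a closed convex cone and $\rho\colon G\to\mathrm{Pos}(C_\rho)$ a homomorphism (so $\rho(g)\in\mathrm{Lin}(V_\rho,V_\rho)$ maps $C_\rho$ into itself, $\rho(gh)=\rho(g)\rho(h)$, $\rho(e)=\mathrm{id}$). $\Phi$ intertwines $\rho$ and $\sigma$ if $\Phi\circ\rho(g)=\sigma(g)\circ\Phi$ for all $g\in G$. The tensor product is $(\rho\otimes\sigma,\ C_\rho\mathbin{\underline{\otimes}}C_\sigma,\ V_\rho\otimes V_\sigma)$, and the dual representation $\rho^*$ acts on $C_\rho^\vee\subseteq V_\rho'$ by $\rho^*(g)=\rho(g^{-1})'$ (transpose). For a representation $\tau$ on $C_\tau\subseteq V_\tau$, $$A(\tau)=\{v\in V_\tau\mid f(v)\ge 0\text{ for all }f\in C_\tau^\vee\text{ with }\tau^*(g)f=f\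 \forall g\in G\}.$$ *)

(* Defs.v *)
From HB Require Import structures.
From mathcomp Require Import all_boot all_order all_algebra.
From mathcomp Require Import all_classical all_reals all_analysis.
Import Order.TTheory GRing.Theory Num.Theory.
Import numFieldNormedType.Exports.
Import VectorInternalTheory.

Set Implicit Arguments.
Unset Strict Implicit.
Unset Printing Implicit Defensive.

Local Open Scope classical_set_scope.
Local Open Scope ring_scope.

(* The topology of a finite-dimensional real vector space, transported from
   R^n through a linear coordinate isomorphism. Linear automorphisms of R^n are
   homeomorphisms, so the choice of coordinates is immaterial. *)
Definition vtop (R : realType) (V : vectType R) : topologicalType :=
  initial_topology (v2r : V -> 'rV[R]_(dim V)).

Section Transpose.
Variables (R : realType) (V W : vectType R).

Definition trans_fun (f : 'Hom(V, W)) (phi : 'Hom(W, R^o)) : 'Hom(V, R^o) :=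
  (phi \o f)%VF.

Fact trans_fun_linear f : linear (trans_fun f).
Proof. by move=> a u v; apply/lfunP => x; rewrite !lfunE /= !lfunE /= !lfunE. Qed.

HB.instance Definition _ f := GRing.isLinear.Build R 'Hom(W, R^o) 'Hom(V, R^o)
  *:%R (trans_fun f) (trans_fun_linear f).

Definition trans (f : 'Hom(V, W)) : 'Hom('Hom(W, R^o), 'Hom(V, R^o)) :=
  linfun (trans_fun f).

Lemma transE f phi : trans f phi = (phi \o f)%VF.
Proof. by rewrite lfunE. Qed.

End Transpose.

Section Tensor.
Variable R : realType.
Implicit Types V W Z : vectType R.

(* The tensor product in coordinates: v (x) w is the rank-one matrix of the
   products of coordinates. The universal property is tensor_universal, and
   tmapE characterises f (x) g. *)
Definition tensor V W : vectType R := 'M[R]_(dim V, dim W).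

Definition tens V W (v : V) (w : W) : tensor V W := (v2r v)^T *m v2r w.

Definition tmap V1 V2 W1 W2 (f : 'Hom(V1, V2)) (g : 'Hom(W1, W2)) :
    'Hom(tensor V1 W1, tensor V2 W2) :=
  linfun (mulmxr (f2mx g) \o mulmx (f2mx f)^T
    : 'M[R]_(dim V1, dim W1) -> 'M[R]_(dim V2, dim W2)).

Lemma v2r_lfun V W (f : 'Hom(V, W)) v : v2r (f v) = v2r v *m f2mx f.
Proof. by rewrite unlock /= r2vK. Qed.

Lemma tmapE V1 V2 W1 W2 (f : 'Hom(V1, V2)) (g : 'Hom(W1, W2)) v w :
  tmap f g (tens v w) = tens (f v) (g w).
Proof. by rewrite lfunE /= /tens !v2r_lfun trmx_mul !mulmxA. Qed.

Lemma tens_bilinear V W :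
  (forall w : W, linear (fun v : V => tens v w)) /\
  (forall v : V, linear (fun w : W => tens v w)).
Proof.
split=> [w a v v'|v a w w']; rewrite /tens linearP.
  by rewrite linearP /= mulmxDl scalemxAl.
by rewrite mulmxDr scalemxAr.
Qed.

Lemma tensor_universal V W Z (b : {bilinear V -> W -> Z}) :
  exists! L : 'Hom(tensor V W, Z), forall v w, L (tens v w) = b v w.
Proof.
pose e i : V := r2v (delta_mx 0 i); pose e' j : W := r2v (delta_mx 0 j).
have tE i j : tens (e i) (e' j) = delta_mx i j.
  rewrite /tens !r2vK; apply/matrixP => k l.
  by rewrite !mxE big_ord1 !mxE !eqxx /= -natrM mulnb.
have eE (U : vectType R) (u : U) : u = \sum_i v2r u 0 i *: r2v (delta_mx 0 i).
  apply: (can_inj v2rK); rewrite linear_sum [LHS]row_sum_delta.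
  by apply: eq_bigr => i _; rewrite linearZ /= r2vK.
pose F (M : tensor V W) : Z := \sum_i \sum_j M i j *: b (e i) (e' j).
have Flin : linear F.
  move=> a M N; rewrite /F scaler_sumr -big_split; apply: eq_bigr => i _ /=.
  rewrite scaler_sumr -big_split; apply: eq_bigr => j _ /=.
  by rewrite !mxE scalerDl scalerA.
pose FL := GRing.isLinear.Build R (tensor V W) Z *:%R F Flin.
pose L : {linear tensor V W -> Z} := HB.pack F FL.
have LP v w : linfun L (tens v w) = b v w.
  rewrite lfunE /= /F [in RHS](eE _ v) [in RHS](eE _ w).
  rewrite linear_sumr exchange_big; apply: eq_bigr => j _ /=.
  rewrite linearZr_LR linear_sumlz /= scaler_sumr; apply: eq_bigr => i _.
  by rewrite linearZl_LR /= scalerA /tens !mxE big_ord1 !mxE mulrC.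
exists (linfun L); split=> // L' L'P; apply/lfunP => M.
rewrite [M]matrix_sum_delta !linear_sum; apply: eq_bigr => i _ /=.
rewrite !linear_sum; apply: eq_bigr => j _ /=.
by rewrite !linearZ /= -tE LP L'P.
Qed.

(* For a subspace X of V this identifies tensor (subvs_of X) W with the
   subspace X (x) W of tensor V W. *)
Lemma tmap_vsval_inj V W (X : {vspace V}) :
  injective (tmap (linfun (vsval : subvs_of X -> V)) (\1%VF : 'End(W))).
Proof.
pose L := linfun (vsproj X).
have LK : (L \o linfun (vsval : subvs_of X -> V))%VF = \1%VF.
  by apply/lfunP => x; rewrite !lfunE /= !lfunE /= vsvalK.
have tmap_comp : forall V1 V2 V3 W1 W2 W3 (f : 'Hom(V2, V3)) (g : 'Hom(W2, W3))
  (f' : 'Hom(V1, V2)) (g' : 'Hom(W1, W2)) t,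
  tmap f g (tmap f' g' t) = tmap (f \o f')%VF (g \o g')%VF t.
  move=> V1 V2 V3 W1 W2 W3 f g f' g' t.
  have f2mxM (A B C : vectType R) (h : 'Hom(B, C)) (h' : 'Hom(A, B)) :
    f2mx (h \o h')%VF = f2mx h' *m f2mx h.
    apply/row_matrixP => i; rewrite !rowE mulmxA.
    by rewrite -[delta_mx 0 i]r2vK -!v2r_lfun lfunE.
  by rewrite !lfunE /= !f2mxM trmx_mul !mulmxA.
have tmap1 (A B : vectType R) t : tmap (\1%VF : 'End(A)) (\1%VF : 'End(B)) t = t.
  have f2mx1 (C : vectType R) : f2mx (\1%VF : 'End(C)) = 1%:M.
    apply/row_matrixP => i; rewrite !rowE mulmx1.
    by rewrite -[delta_mx 0 i]r2vK -!v2r_lfun lfunE.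
  by rewrite lfunE /= !f2mx1 trmx1 mul1mx mulmx1.
apply: (can_inj (g := tmap L \1%VF)) => t.
by rewrite tmap_comp LK comp_lfun1l tmap1.
Qed.

End Tensor.

Section Cones.
Variable R : realType.
Implicit Types V W Z : vectType R.

Definition convex_cone V (C : set V) : Prop :=
  [/\ C 0, forall x y, C x -> C y -> C (x + y)
    & forall (a : R) x, 0 <= a -> C x -> C (a *: x)].

Definition sharp V (C : set V) : Prop := C `&` [set x | C (- x)] = [set 0].

Definition positive_maps V W (C : set V) (D : set W) : set 'Hom(V, W) :=
  [set Phi : 'Hom(V, W) | forall x, C x -> D (Phi x)].

Definition dual_cone V (C : set V) : set 'Hom(V, R^o) :=
  [set phi : 'Hom(V, R^o) | forall x, C x -> (0 : R) <= phi x].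

Definition tensor_cone V W (C : set V) (D : set W) : set (tensor V W) :=
  [set t | exists (n : nat) (c : 'I_n -> V) (d : 'I_n -> W),
    [/\ forall i, C (c i), forall i, D (d i) & t = \sum_i tens (c i) (d i)]].

End Cones.

(* The data of a triple (rho, C, V); the axioms are in [representation], since
   Aset below makes sense for any such triple. *)
Record cone_action (R : realType) (G : groupType) := ConeAction {
  carrier : vectType R;
  cone : set carrier;
  act : G -> 'End(carrier) }.
Arguments cone {R G} c.
Arguments act {R G} c.

Section Representations.
Variables (R : realType) (G : groupType).
Implicit Types rho sigma tau : cone_action R G.

Definition representation rho : Prop :=
  [/\ closed (cone rho : set (vtop (carrier rho))),
      convex_cone (cone rho),
      forall g, positive_maps (cone rho) (cone rho) (act rho g),
      forall g h, act rho (g * h)%g = (act rho g \o act rho h)%VF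
    & act rho 1%g = \1%VF].

Definition intertwines rho sigma (Phi : 'Hom(carrier rho, carrier sigma)) : Prop :=
  forall g, (Phi \o act rho g)%VF = (act sigma g \o Phi)%VF.

Definition tensor_rep rho sigma : cone_action R G :=
  ConeAction (tensor_cone (cone rho) (cone sigma))
    (fun g => tmap (act rho g) (act sigma g)).

Definition dual_rep rho : cone_action R G :=
  ConeAction (dual_cone (cone rho)) (fun g => trans (act rho g^-1%g)).

Definition Aset tau : set (carrier tau) :=
  [set v | forall f : 'Hom(carrier tau, R^o),
    cone (dual_rep tau) f -> (forall g, act (dual_rep tau) g f = f) ->
    (0 : R) <= f v].

End Representations.
Arguments intertwines {R G} rho sigma Phi.
Arguments Aset {R G} tau _.

(* Main.v *)
Require Import Defs.
From HB Require Import structures.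
From mathcomp Require Import all_boot all_order all_algebra.
From mathcomp Require Import all_classical all_reals all_analysis.
From mathcomp Require Import ring lra.
Import Order.TTheory GRing.Theory Num.Theory.
Import numFieldNormedType.Exports.
Import VectorInternalTheory.

Set Implicit Arguments.
Unset Strict Implicit.
Unset Printing Implicit Defensive.

Local Open Scope classical_set_scope.
Local Open Scope ring_scope.

(** The theorem is a duality statement about one closed convex cone [F]: the
    functionals [f] on [V_rho (x) V_sigma'] that are nonnegative on the tensor
    cone of [C_rho] and the dual of [C_sigma], and invariant under [G].

    Such an [f] is the same thing as a linear map [Phi : V_rho -> V_sigma]
    through [f (v (x) phi) = phi (Phi v)]; because [C_sigma] is its own bidual
    ([bipolar]), positivity of [f] says that [Phi] is positive, and invariance
    of [f] says that [Phi] intertwines ([positive_map_of_functional],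
    [intertwiner_of_functional]). With [sigma'] the dual representation,
    [A(rho (x) sigma')] is by definition the set of vectors on which every
    member of [F] is nonnegative.

    Necessity: composing with [Phi (x) id] turns a positive invariant
    functional for [sigma (x) sigma'] into one for [rho (x) sigma'], so
    [Phi (x) id] respects the sets [A] ([Aset_intertwiner]).

    Sufficiency: let [ev] be the evaluation functional [w (x) phi |-> phi w],
    which is positive and invariant for [sigma (x) sigma']. A positive
    intertwiner extending [Psi] is exactly a member of [F] whose restriction
    to [X (x) V_sigma'] is [ev o (Psi (x) id)]. The hypothesis says that every
    [t] on which all restrictions of members of [F] are nonnegative also gives
    [ev ((Psi (x) id) t) >= 0]. So the functional lies in the restriction of
    [F] as soon as that restricted cone is closed, by separation.

    A linear image of a closed cone need not be closed, but it is when the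
    kernel of the linear map meets the cone only in 0. This is the role of the
    sharpness of [C_sigma] and of the interior point of [C_rho] in [X]: if [f]
    in [F] vanishes on [X (x) V_sigma'], the map [Phi] vanishes at that point,
    so every value of [Phi], and its opposite, lies in [C_sigma]
    ([positive_map_eq0]). Closedness and separation come together, from the
    existence of a nearest point in the image cone ([mem_image_cone], whose
    coordinate form is [separation_image_cone]). *)

(** * Nearest points in the image of a closed cone *)

Section DotProduct.
Variables (R : realType) (n : nat).
Implicit Types u v : 'rV[R]_n.

Definition dotrv u v : R := (u *m v^T) 0 0.

Lemma dotrvE u v : dotrv u v = \sum_i u 0 i * v 0 i.
Proof. by rewrite /dotrv mxE; apply: eq_bigr => i _; rewrite mxE. Qed.

Lemma dotrvC u v : dotrv u v = dotrv v u.
Proof. by rewrite !dotrvE; apply: eq_bigr => i _; rewrite mulrC. Qed.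

Lemma dotrvDl u v w : dotrv (u + v) w = dotrv u w + dotrv v w.
Proof. by rewrite /dotrv mulmxDl mxE. Qed.

Lemma dotrvZl a u w : dotrv (a *: u) w = a * dotrv u w.
Proof. by rewrite /dotrv -scalemxAl mxE. Qed.

Lemma dotrv_ge0 u : 0 <= dotrv u u.
Proof. by rewrite dotrvE; apply: sumr_ge0 => i _; rewrite -expr2 sqr_ge0. Qed.

Lemma dotrv_eq0 u : (dotrv u u == 0) = (u == 0).
Proof.
apply/idP/eqP => [|->]; last by rewrite /dotrv mul0mx mxE.
rewrite dotrvE psumr_eq0 => [/allP u0|i _]; last by rewrite -expr2 sqr_ge0.
apply/rowP => i; apply/eqP; rewrite mxE.
by have := u0 i (mem_index_enum i); rewrite -expr2 sqrf_eq0.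
Qed.

Lemma dotrv_sqD u v (s : R) :
  dotrv (u + s *: v) (u + s *: v)
  = dotrv u u + 2 * s * dotrv u v + s ^+ 2 * dotrv v v.
Proof.
rewrite dotrvDl dotrvZl ![dotrv _ (_ + _)]dotrvC !dotrvDl !dotrvZl.
rewrite [dotrv v u]dotrvC; ring.
Qed.

End DotProduct.

Lemma coord_mulmx_continuous (R : realType) n m (A : 'M[R]_(n, m)) j :
  continuous (fun x : 'rV[R]_n => (x *m A) 0 j).
Proof.
rewrite (_ : (fun x => _) =
    fun x : 'rV[R]_n => \sum_i x 0 i * A i j); last first.
  by apply/funext => x; rewrite mxE.
apply: continuous_big => [|i _].
  by move=> x; exact: (@add_continuous R x).
move=> x; apply: (@continuousM R _ (fun x : 'rV[R]_n => x 0 i) (fun=> A i j)).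
  exact: coord_continuous.
exact: cst_continuous.
Qed.

Lemma dotrv_affine_continuous (R : realType) n m (A : 'M[R]_(n, m)) b :
  continuous (fun x : 'rV[R]_n => dotrv (x *m A - b) (x *m A - b)).
Proof.
rewrite (_ : (fun x => _) = fun x : 'rV[R]_n =>
    \sum_i ((x *m A) 0 i - b 0 i) * ((x *m A) 0 i - b 0 i)); last first.
  by apply/funext => x; rewrite dotrvE; apply: eq_bigr => i _; rewrite !mxE.
apply: continuous_big => [|i _].
  by move=> x; exact: (@add_continuous R x).
have affc : continuous (fun x : 'rV[R]_n => (x *m A) 0 i - b 0 i).
  move=> x; apply: (@continuousB R R^o _
    (fun x : 'rV[R]_n => (x *m A) 0 i) (fun=> b 0 i)).
    exact: coord_mulmx_continuous.
  exact: cst_continuous.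
by move=> x; exact: (@continuousM R _ _ _ x (affc x) (affc x)).
Qed.

Section NearestPoint.
Variables (R : realType) (n m : nat) (K : set 'rV[R]_n) (A : 'M[R]_(n, m)).
Hypothesis clK : closed K.
Hypothesis K0 : K 0.
Hypothesis KD : forall x y, K x -> K y -> K (x + y).
Hypothesis KZ : forall (a : R) x, 0 <= a -> K x -> K (a *: x).
Hypothesis K_ker : forall k, K k -> k *m A = 0 -> k = 0.

(** The image of the unit vectors of [K] stays away from 0 by compactness, and
    homogeneity spreads this to the whole cone. The trivial cone has no unit
    vector and is treated apart. *)
Lemma coercive_cone :
  exists2 c : R, 0 < c &
    forall k, K k -> c * `|k| ^+ 2 <= dotrv (k *m A) (k *m A).
Proof.
pose S := K `&` [set k | `|k| = 1].
have cS : compact S.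
  apply: bounded_closed_compact.
    by exists 1; split => // M M1 k /= [_ ->]; exact: ltW.
  apply: closedI => //.
  apply: (@preimage_closed _ _ (fun k : 'rV[R]_n => `|k|) [set 1]).
    by move=> k _; exact: norm_continuous.
  exact: closed_eq.
have qc : continuous (fun k : 'rV[R]_n => dotrv (k *m A) (k *m A)).
  rewrite (_ : (fun k => _) = fun k => dotrv (k *m A - 0) (k *m A - 0)).
    exact: dotrv_affine_continuous.
  by apply/funext => k; rewrite subr0.
have [S0|/set0P S0] := eqVneq S set0.
  exists 1 => // k Kk; have [->|k0] := eqVneq k 0.
    by rewrite normr0 expr0n mulr0 dotrv_ge0.
  have : S (`|k|^-1 *: k).
    by split; [apply: KZ; rewrite ?invr_ge0 | exact: normfZV].
  by rewrite S0.
have [k1 /set_mem[Kk1 k1n] k1min] := EVT_min_rV S0 cS (continuous_subspaceT qc).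
exists (dotrv (k1 *m A) (k1 *m A)).
  rewrite lt_neqAle dotrv_ge0 andbT eq_sym dotrv_eq0.
  apply: contra_eq_neq k1n => /(K_ker Kk1) ->.
  by rewrite normr0 eq_sym oner_neq0.
move=> k Kk; have [->|k0] := eqVneq k 0.
  by rewrite normr0 expr0n mulr0 dotrv_ge0.
have Sk : S (`|k|^-1 *: k).
  by split; [apply: KZ; rewrite ?invr_ge0 | exact: normfZV].
have := k1min _ (mem_set Sk).
rewrite -scalemxAl dotrvZl dotrvC dotrvZl mulrA -expr2 exprVn mulrC.
by rewrite ler_pdivlMr // exprn_gt0 // normr_gt0.
Qed.

(** Coercivity makes the distance from [k *m A] to [y] larger far away than at
    [k = 0], so a minimum over a compact part of [K] is a minimum over [K]. *)
Lemma nearest_point y : exists2 k0, K k0 &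
  forall k, K k ->
    dotrv (k0 *m A - y) (k0 *m A - y) <= dotrv (k *m A - y) (k *m A - y).
Proof.
have [c c0 cK] := coercive_cone.
(* [c * r >= 4 * dotrv y y], so the image of a vector [k] of [K] outside the
   ball of radius [r] is at least twice as long as [y], hence at least as far
   from [y] as 0 is. The summand 1 gives [r <= `|k| ^+ 2] for such [k]. *)
pose r := 1 + 4 * dotrv y y / c.
have r1 : 1 <= r by rewrite lerDl divr_ge0 ?mulr_ge0 ?dotrv_ge0 ?ltW.
pose B := K `&` [set k | `|k| <= r].
have cB : compact B.
  apply: bounded_closed_compact.
    exists r; split=> [|M rM]; first exact: num_real.
    by move=> k /= [_ /le_trans]; apply; exact: ltW.
  apply: closedI => //.
  apply: (@preimage_closed _ _ (fun k : 'rV[R]_n => `|k|) [set x | x <= r]).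
    by move=> k _; exact: norm_continuous.
  exact: closed_le.
have B0 : B 0 by split=> //=; rewrite normr0 (le_trans ler01).
have [k0 /set_mem[Kk0 _] k0min] := EVT_min_rV (ex_intro _ 0 B0) cB
  (continuous_subspaceT (@dotrv_affine_continuous _ _ _ A y)).
exists k0 => // k Kk.
have [kr|rk] := leP `|k| r; first by apply: k0min; exact: mem_set.
have q0 := k0min _ (mem_set B0).
apply: (le_trans q0); rewrite mul0mx sub0r.
have qN : dotrv (- y) (- y) = dotrv y y.
  by rewrite -scaleN1r dotrvZl dotrvC dotrvZl mulrA mulrNN !mul1r.
rewrite qN.
have e1 : dotrv (k *m A - y) (k *m A - y) =
    dotrv (k *m A) (k *m A) + 2 * -1 * dotrv (k *m A) y + (-1) ^+ 2 * dotrv y y.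
  by rewrite -dotrv_sqD scaleN1r.
have e2 : 0 <= dotrv (k *m A) (k *m A) + 2 * - 2 * dotrv (k *m A) y
    + (-2) ^+ 2 * dotrv y y.
  by rewrite -dotrv_sqD dotrv_ge0.
have e3 : 4 * dotrv y y <= dotrv (k *m A) (k *m A).
  apply: le_trans (cK _ Kk).
  have : r <= `|k| ^+ 2.
    apply: (le_trans (ltW rk)).
    by rewrite expr2 ler_peMr // (le_trans r1) // ltW.
  rewrite -(ler_pM2l c0); apply: le_trans.
  rewrite /r mulrDr mulr1 mulrCA divff ?gt_eqF // mulr1.
  by rewrite lerDr ltW.
rewrite e1; lra.
Qed.

(** If [k0 *m A] is nearest to [y], the vector [z := k0 *m A - y] is nonnegative
    on the image cone and nonpositive at [k0 *m A] itself: otherwise moving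
    [k0] towards [k0 + k], or towards 0, would bring the image closer to [y].
    The hypothesis on [y], applied to [z], then makes the square of [z]
    nonpositive. *)
Lemma separation_image_cone y :
  (forall t : 'rV[R]_m,
     (forall k, K k -> 0 <= dotrv (k *m A) t) -> 0 <= dotrv y t) ->
  exists2 k, K k & k *m A = y.
Proof.
move=> ysep; have [k0 Kk0 k0min] := nearest_point y.
exists k0 => //; set z := k0 *m A - y in k0min *.
have zge0 : forall k, K k -> 0 <= dotrv (k *m A) z.
  move=> k Kk; rewrite leNgt; apply/negP => neg.
  pose q := dotrv (k *m A) (k *m A).
  have q0 : 0 <= q by exact: dotrv_ge0.
  (* a step [s] small enough for the first-order decrease to dominate
     [s ^+ 2 * q]; the [+ 1] keeps the denominator nonzero *)
  pose s := - dotrv (k *m A) z / (q + 1).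
  have s0 : 0 < s by rewrite divr_gt0 ?oppr_gt0 // ltr_wpDl.
  have := k0min _ (KD Kk0 (KZ (ltW s0) Kk)).
  rewrite mulmxDl addrAC -/z -scalemxAl dotrv_sqD (dotrvC z (k *m A)) -/q.
  have sE : dotrv (k *m A) z = - (s * (q + 1)).
    by rewrite /s divfK ?opprK // gt_eqF // ltr_wpDl.
  rewrite sE; apply/negP; rewrite -ltNge; nra.
have k0le0 : dotrv (k0 *m A) z <= 0.
  rewrite leNgt; apply/negP => pos.
  pose q := dotrv (k0 *m A) (k0 *m A).
  have q0 : 0 <= q by exact: dotrv_ge0.
  (* the same step, with a denominator that also ensures [s <= 1] *)
  pose s := dotrv (k0 *m A) z / (q + dotrv (k0 *m A) z).
  have d0 : 0 < q + dotrv (k0 *m A) z by rewrite ltr_wpDl.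
  have s0 : 0 < s by rewrite divr_gt0.
  have s1 : 0 <= 1 - s by rewrite subr_ge0 ler_pdivrMr // mul1r lerDr.
  have := k0min _ (KZ s1 Kk0).
  rewrite scalerBl scale1r mulmxBl addrAC -/z -scalemxAl -scaleNr dotrv_sqD.
  rewrite (dotrvC z (k0 *m A)) -/q.
  have sE : dotrv (k0 *m A) z = s * (q + dotrv (k0 *m A) z).
    by rewrite /s divfK ?opprK // gt_eqF // ltr_wpDl.
  apply/negP; rewrite -ltNge; nra.
have yz := ysep z zge0.
have zz : dotrv z z = dotrv (k0 *m A) z - dotrv y z.
  by rewrite {1}/z dotrvDl -scaleN1r dotrvZl mulN1r.
have : dotrv z z <= 0 by rewrite zz; lra.
by move=> z0; apply/eqP; rewrite -subr_eq0 -/z -dotrv_eq0 eq_le z0 dotrv_ge0.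
Qed.

End NearestPoint.

(** * Closed cones in finite-dimensional spaces *)

Section VectorCones.
Variable R : realType.
Implicit Types V U : vectType R.

Lemma r2v_continuous V : continuous (r2v : 'rV[R]_(dim V) -> vtop V).
Proof.
apply: continuous_comp_initial => x.
rewrite (_ : _ \o _ = id); first exact: cvg_id.
by apply/funext => u /=; rewrite r2vK.
Qed.

Lemma functional_continuous V (phi : 'Hom(V, R^o)) :
  continuous (phi : vtop V -> R).
Proof.
pose c : 'cV[R]_(dim V) := \col_i (phi (r2v (delta_mx 0 i)) : R).
have phiE : (phi : V -> R) = (fun x : 'rV[R]_(dim V) => (x *m c) 0 0) \o v2r.
  apply/funext => v /=.
  rewrite -[in LHS](v2rK v) [in LHS](row_sum_delta (v2r v)).
  rewrite !linear_sum mxE; apply: eq_bigr => i _.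
  by rewrite !linearZ /= mxE.
rewrite phiE => v.
apply: continuous_comp; first exact: initial_continuous.
exact: coord_mulmx_continuous.
Qed.

Lemma interior_direction V (C : set V) (x v : V) :
  interior (C : set (vtop V)) x -> exists2 e : R, 0 < e & C (x + e *: v).
Proof.
move=> Cx.
pose h (e : R) : vtop V := (x + e *: v : V).
have hc : continuous h.
  apply: continuous_comp_initial.
  rewrite (_ : _ \o _ = fun e : R => v2r x + e *: v2r v); last first.
    by apply/funext => e /=; rewrite /h linearD linearZ.
  move=> e; apply: (@continuousD R 'rV[R]_(dim V) R
    (fun=> v2r x) ( *:%R^~ (v2r v))); first exact: cst_continuous.
  exact: scalel_continuous.
have C0 : nbhs (h 0) (C : set (vtop V)) by rewrite /h scale0r addr0.
have hC : \forall e \near (0 : R)^'+, C (h e).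
  exact: (cvg_at_right_filter (hc 0) C0).
near (0 : R)^'+ => e; exists e; first by near: e; exact: nbhs_right_gt.
by near: e.
Unshelve. all: by end_near. Qed.

(** A form of Farkas' lemma for a cone that need not be finitely generated: the
    triviality of the kernel on [K] is what makes the image cone closed. *)
Lemma mem_image_cone V U (K : set V) (A : 'Hom(V, U)) (y : U) :
  closed (K : set (vtop V)) -> convex_cone K ->
  (forall k, K k -> A k = 0 -> k = 0) ->
  (forall phi : 'Hom(U, R^o),
     (forall k, K k -> (0 : R) <= phi (A k)) -> (0 : R) <= phi y) ->
  exists2 k, K k & A k = y.
Proof.
move=> clK [K0 KD KZ] Kker ysep.
have [||||||k Kk kA] := @separation_image_cone R _ _
    ((r2v : _ -> V) @^-1` K) (f2mx A) _ _ _ _ _ (v2r y).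
- by apply: (@preimage_closed _ (vtop V)) => // x _; exact: r2v_continuous.
- by rewrite /preimage /= linear0.
- by move=> u v /= Ku Kv; rewrite linearD; exact: KD.
- by move=> a u a0 /= Ku; rewrite linearZ; exact: KZ.
- move=> k /= Kk kA0; have : A (r2v k) = 0.
    by apply: (can_inj v2rK); rewrite v2r_lfun r2vK kA0 linear0.
  by move/(Kker _ Kk) => k0; apply: (can_inj r2vK); rewrite k0 linear0.
- move=> t tK.
  pose f (u : U) : R^o := dotrv (v2r u) t.
  have flin : linear f.
    by move=> a u v; rewrite /f linearP dotrvDl dotrvZl.
  pose FL := GRing.isLinear.Build R U R^o *:%R f flin.
  pose L : {linear U -> R^o} := HB.pack f FL.
  have LE u : linfun L u = f u by rewrite lfunE.
  have := ysep (linfun L); rewrite LE; apply=> k Kk.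
  by rewrite LE /f v2r_lfun; apply: tK; rewrite /= v2rK.
by exists (r2v k) => //; apply: (can_inj v2rK); rewrite v2r_lfun r2vK.
Qed.

Lemma bipolar V (C : set V) x :
  closed (C : set (vtop V)) -> convex_cone C ->
  (forall phi, dual_cone C phi -> (0 : R) <= phi x) -> C x.
Proof.
move=> clC cC xC.
have [||k Ck] := @mem_image_cone _ _ C \1%VF x clC cC.
- by move=> k _; rewrite id_lfunE.
- by move=> phi Cphi; apply: xC => k Ck; have := Cphi k Ck; rewrite id_lfunE.
by rewrite id_lfunE => <-.
Qed.

Definition evalf_fun V (v : V) (phi : 'Hom(V, R^o)) : R^o := phi v.

Fact evalf_fun_linear V (v : V) : linear (evalf_fun v).
Proof. by move=> a phi psi; rewrite /evalf_fun lfunE /= lfunE. Qed.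

HB.instance Definition _ V (v : V) := GRing.isLinear.Build R 'Hom(V, R^o) R^o
  *:%R (evalf_fun v) (evalf_fun_linear v).

Definition evalf V (v : V) : 'Hom('Hom(V, R^o), R^o) := linfun (evalf_fun v).

Lemma evalfE V (v : V) phi : evalf v phi = phi v.
Proof. by rewrite lfunE. Qed.

Lemma closed_dual_cone V (S : set V) :
  closed (dual_cone S : set (vtop 'Hom(V, R^o))).
Proof.
rewrite (_ : dual_cone S = \bigcap_(s in S) evalf s @^-1` [set x : R | 0 <= x]).
  apply: closed_bigI => s _; apply: (@preimage_closed (vtop _) R).
    by move=> phi _; exact: functional_continuous.
  exact: closed_ge.
apply/seteqP; split => phi Sphi s Ss; first by rewrite /= evalfE; exact: Sphi.
by have := Sphi s Ss; rewrite /= evalfE.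
Qed.

Lemma convex_dual_cone V (S : set V) : convex_cone (dual_cone S).
Proof.
split=> [s Ss|f g Sf Sg s Ss|a f a0 Sf s Ss]; rewrite lfunE //=.
  by apply: addr_ge0; [exact: Sf | exact: Sg].
by apply: mulr_ge0 => //; exact: Sf.
Qed.

End VectorCones.

(** * Functionals on tensor products *)

Section Duality.
Variable R : realType.
Implicit Types V W Z : vectType R.

Definition coordf W (j : 'I_(\dim {:W})) : 'Hom(W, R^o) :=
  linfun (coord (vbasis {:W}) j).

Lemma functional_expansion W (phi : 'Hom(W, R^o)) :
  phi = \sum_(j < \dim {:W}) (phi (vbasis {:W})`_j : R) *: coordf j.
Proof.
apply/lfunP => w; rewrite [in LHS](coord_vbasis (memvf w)) linear_sum sum_lfunE.
by apply: eq_bigr => j _; rewrite linearZ lfunE /= lfunE /= [LHS]mulrC.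
Qed.

Lemma functional_separation W (w w' : W) :
  (forall phi : 'Hom(W, R^o), phi w = phi w') -> w = w'.
Proof.
move=> ww'; rewrite (coord_vbasis (memvf w)) (coord_vbasis (memvf w')).
by apply: eq_bigr => j _; have := ww' (coordf j); rewrite !lfunE /= => ->.
Qed.

Lemma dual_reflexive V (psi : 'Hom('Hom(V, R^o), R^o)) :
  exists v : V, psi = evalf v.
Proof.
exists (\sum_j (psi (coordf j) : R) *: (vbasis {:V})`_j).
apply/lfunP => phi; rewrite evalfE linear_sum.
rewrite [in LHS](functional_expansion phi) linear_sum; apply: eq_bigr => j _.
by rewrite !linearZ /= [LHS]mulrC.
Qed.

HB.instance Definition _ V W :=
  bilinear_isBilinear.Build R V W (tensor V W) *:%R *:%R (@tens R V W)
    ((tens_bilinear V W).1, (tens_bilinear V W).2).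

Lemma tensor_ext V W Z (f g : 'Hom(tensor V W, Z)) :
  (forall v w, f (tens v w) = g (tens v w)) -> f = g.
Proof.
move=> fg; apply/lfunP => t.
have -> : t = \sum_i \sum_j
    t i j *: tens (r2v (delta_mx 0 i) : V) (r2v (delta_mx 0 j) : W).
  rewrite [LHS]matrix_sum_delta; apply: eq_bigr => i _; apply: eq_bigr => j _.
  congr (_ *: _); rewrite /tens !r2vK; apply/matrixP => k l.
  by rewrite !mxE big_ord1 !mxE !eqxx /= -natrM mulnb.
rewrite !linear_sum; apply: eq_bigr => i _; rewrite !linear_sum.
by apply: eq_bigr => j _; rewrite !linearZ /= fg.
Qed.

Lemma tmap_comp V1 V2 V3 W1 W2 W3 (f : 'Hom(V2, V3)) (f' : 'Hom(V1, V2))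
    (g : 'Hom(W2, W3)) (g' : 'Hom(W1, W2)) :
  (tmap f g \o tmap f' g')%VF = tmap (f \o f')%VF (g \o g')%VF.
Proof. by apply: tensor_ext => v w; rewrite comp_lfunE !tmapE !comp_lfunE. Qed.

(** The inverse of the map sending [Phi] to the functional
    [v (x) phi |-> phi (Phi v)]. *)
Lemma tensor_functional_hom V W (f : 'Hom(tensor V 'Hom(W, R^o), R^o)) :
  exists Phi : 'Hom(V, W), forall v phi, f (tens v phi) = phi (Phi v).
Proof.
pose F v : W := \sum_j (f (tens v (coordf j)) : R) *: (vbasis {:W})`_j.
have Flin : linear F.
  move=> a u v; rewrite /F scaler_sumr -big_split; apply: eq_bigr => j _ /=.
  by rewrite linearPl /= linearP /= scalerDl scalerA.
pose FL := GRing.isLinear.Build R V W *:%R F Flin.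
pose L : {linear V -> W} := HB.pack F FL.
exists (linfun L) => v phi; rewrite lfunE /= /F linear_sum.
rewrite [in LHS](functional_expansion phi) linear_sumr linear_sum.
by apply: eq_bigr => j _; rewrite linearZr_LR !linearZ /= [LHS]mulrC.
Qed.

(** The functional that corresponds to the identity of [W], i.e. the trace when
    [W (x) W'] is read as the space of endomorphisms of [W]. *)
Lemma evaluation_functional W :
  exists ev : 'Hom(tensor W 'Hom(W, R^o), R^o),
    forall w phi, ev (tens w phi) = phi w.
Proof.
pose b (w : W) (phi : 'Hom(W, R^o)) : R^o := phi w.
have bbil : bilinear_for *:%R *:%R b.
  by split=> [phi|w] a x y; rewrite /b ?linearP // lfunE /= lfunE.
pose BB := bilinear_isBilinear.Build R W 'Hom(W, R^o) R^o *:%R *:%R b bbil.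
pose B : {bilinear W -> 'Hom(W, R^o) -> R^o} := HB.pack b BB.
by have [ev [evP _]] := tensor_universal B; exists ev.
Qed.

End Duality.

(** * Positive maps and positive invariant functionals *)

Section PositiveMaps.
Variable R : realType.
Implicit Types V W : vectType R.

Lemma sharp_eq0 W (D : set W) w : sharp D -> D w -> D (- w) -> w = 0.
Proof.
move=> shD Dw DNw; have : (D `&` [set x | D (- x)]) w by [].
by rewrite shD.
Qed.

(** Every direction [u] can be reached from an interior point [x] while staying
    in [C], so [Phi x = 0] puts both [Phi u] and [Phi (- u)] in [D]. *)
Lemma positive_map_eq0 V W (C : set V) (D : set W) (Phi : 'Hom(V, W)) (x : V) :
  convex_cone D -> sharp D -> interior (C : set (vtop V)) x ->
  positive_maps C D Phi -> Phi x = 0 -> Phi = 0.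
Proof.
move=> [_ _ DZ] shD Cx Phipos Phix; apply/lfunP => v; rewrite zero_lfunE.
have DPhi u : D (Phi u).
  have [e e0 Ce] := interior_direction u Cx.
  have := Phipos _ Ce; rewrite linearD linearZ /= Phix add0r => De.
  rewrite -[Phi u](scalerK (lt0r_neq0 e0)).
  by apply: DZ => //; rewrite invr_ge0 ltW.
by apply: (sharp_eq0 shD (DPhi v)); rewrite -linearN; exact: DPhi.
Qed.

Lemma dual_tensor_coneP V W (C : set V) (D : set W) f :
  dual_cone (tensor_cone C D) f <->
  (forall c d, C c -> D d -> (0 : R) <= f (tens c d)).
Proof.
split=> [fCD c d Cc Dd|fCD _ [n [c [d [Cc Dd ->]]]]]; last first.
  by rewrite linear_sum; apply: sumr_ge0 => i _; exact: fCD.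
apply: fCD; exists 1%N, (fun=> c), (fun=> d); split => //.
by rewrite big_ord1.
Qed.

Lemma positive_map_of_functional V W (C : set V) (D : set W)
    (f : 'Hom(tensor V 'Hom(W, R^o), R^o)) (Phi : 'Hom(V, W)) :
  closed (D : set (vtop W)) -> convex_cone D ->
  (forall v phi, f (tens v phi) = phi (Phi v)) ->
  dual_cone (tensor_cone C (dual_cone D)) f -> positive_maps C D Phi.
Proof.
move=> clD cD fPhi /dual_tensor_coneP fpos c Cc.
by apply: bipolar => // phi Dphi; rewrite -fPhi; exact: fpos.
Qed.

End PositiveMaps.

Definition positive_invariants (R : realType) (G : groupType)
    (tau : cone_action R G) : set 'Hom(carrier tau, R^o) :=
  [set f | cone (dual_rep tau) f /\ forall g, act (dual_rep tau) g f = f].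
Arguments positive_invariants {R G} tau _.

Section Invariants.
Variables (R : realType) (G : groupType).
Implicit Types rho sigma tau : cone_action R G.

(** Invariance is a family of linear inequalities, [u] and [- u] together giving
    an equality; hence positive invariant functionals form a dual cone, and so
    a closed convex cone. *)
Lemma positive_invariantsE tau :
  positive_invariants tau =
  dual_cone (cone tau `|` [set s | exists g u, s = act tau g u - u]).
Proof.
apply/seteqP; split => f.
  move=> [fpos finv] s [|[g [u ->]]]; first exact: fpos.
  have := finv g^-1%g; rewrite /= transE invgK => fg.
  by rewrite linearB /= -comp_lfunE fg subrr.
move=> fS; split=> [s Cs|g]; first by apply: fS; left.
have fge u : (0 : R) <= f (act tau g^-1%g u) - f u.
  by rewrite -linearB; apply: fS; right; exists g^-1%g, u.
rewrite /= transE; apply/lfunP => u; rewrite comp_lfunE.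
apply/eqP; rewrite eq_le -(subr_ge0 (f u)) fge andbT -subr_ge0.
by have := fge (- u); rewrite linearN (linearN f) (linearN f) opprK addrC.
Qed.

Lemma closed_positive_invariants tau :
  closed (positive_invariants tau : set (vtop 'Hom(carrier tau, R^o))).
Proof. by rewrite positive_invariantsE; exact: closed_dual_cone. Qed.

Lemma convex_positive_invariants tau : convex_cone (positive_invariants tau).
Proof. by rewrite positive_invariantsE; exact: convex_dual_cone. Qed.

Lemma act_invK tau g v :
  representation tau -> act tau g^-1%g (act tau g v) = v.
Proof.
by case=> _ _ _ tauM tau1; rewrite -comp_lfunE -tauM mulVg tau1 id_lfunE.
Qed.

Lemma act_Kinv tau g v :
  representation tau -> act tau g (act tau g^-1%g v) = v.
Proof. by move=> Htau; rewrite -{1}[g]invgK act_invK. Qed.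

Lemma invariant_tensorP rho tau
    (f : 'Hom(tensor (carrier rho) (carrier tau), R^o)) :
  (forall g, act (dual_rep (tensor_rep rho tau)) g f = f) <->
  (forall g v w, f (tens (act rho g v) (act tau g w)) = f (tens v w)).
Proof.
split=> [finv g v w|finv g].
  have := finv g^-1%g; rewrite /= transE invgK => fE.
  by rewrite -[in RHS]fE comp_lfunE tmapE.
by rewrite /= transE; apply: tensor_ext => v w; rewrite comp_lfunE tmapE.
Qed.

Lemma intertwiner_of_functional rho sigma
    (f : 'Hom(tensor (carrier rho) 'Hom(carrier sigma, R^o), R^o))
    (Phi : 'Hom(carrier rho, carrier sigma)) :
  representation sigma -> (forall v phi, f (tens v phi) = phi (Phi v)) ->
  (forall g, act (dual_rep (tensor_rep rho (dual_rep sigma))) g f = f) ->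
  intertwines rho sigma Phi.
Proof.
move=> Hsigma fPhi /invariant_tensorP finv g.
apply/lfunP => v; rewrite !comp_lfunE; apply: functional_separation => phi.
(* [phi \o act sigma g] is carried to [phi] by the dual action of [g] *)
have := finv g v (phi \o act sigma g)%VF.
by rewrite /= transE !fPhi !comp_lfunE act_Kinv.
Qed.

Lemma Aset_intertwiner rho sigma tau
    (Phi : 'Hom(carrier rho, carrier sigma)) t :
  positive_maps (cone rho) (cone sigma) Phi -> intertwines rho sigma Phi ->
  Aset (tensor_rep rho tau) t -> Aset (tensor_rep sigma tau) (tmap Phi \1%VF t).
Proof.
move=> Phipos Phii At f /dual_tensor_coneP fpos /invariant_tensorP finv.
rewrite -(comp_lfunE f); apply: At.
  apply/dual_tensor_coneP => c d Cc Dd; rewrite comp_lfunE tmapE id_lfunE.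
  by apply: fpos => //; exact: Phipos.
apply/invariant_tensorP => g v w; rewrite !comp_lfunE !tmapE !id_lfunE.
by rewrite -(comp_lfunE Phi) Phii comp_lfunE finv.
Qed.

Lemma evaluation_positive_invariant sigma
    (ev : 'Hom(tensor (carrier sigma) 'Hom(carrier sigma, R^o), R^o)) :
  representation sigma -> (forall w phi, ev (tens w phi) = phi w) ->
  positive_invariants (tensor_rep sigma (dual_rep sigma)) ev.
Proof.
move=> Hsigma evE; split.
  by apply/dual_tensor_coneP => d phi Dd Dphi; rewrite evE; exact: Dphi.
apply/invariant_tensorP => g w phi.
by rewrite /= transE !evE comp_lfunE act_invK.
Qed.

(** If [f] vanishes on [X (x) V_sigma'], the corresponding map kills [X], and in
    particular an interior point of [C_rho]. This is the kernel condition of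
    [mem_image_cone] for the restriction of functionals to [X (x) V_sigma']. *)
Lemma positive_invariant_eq0 rho sigma (X : {vspace carrier rho}) x f :
  representation sigma -> sharp (cone sigma) ->
  x \in X -> interior (cone rho : set (vtop (carrier rho))) x ->
  positive_invariants (tensor_rep rho (dual_rep sigma)) f ->
  (f \o tmap (linfun (vsval : subvs_of X -> _)) \1%VF)%VF = 0 -> f = 0.
Proof.
move=> [clD cD _ _ _] Hsharp Xx Cx [fpos _] fX0.
have [Phi fPhi] := tensor_functional_hom f.
have Phipos := positive_map_of_functional clD cD fPhi fpos.
suff Phi0 : Phi = 0.
  by apply: tensor_ext => v phi; rewrite fPhi Phi0 !zero_lfunE linear0.
apply: (positive_map_eq0 cD Hsharp Cx Phipos).
apply: functional_separation => phi; rewrite linear0 -fPhi.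
have := congr1 (fun h : 'Hom(_, _) => h (tens (vsproj X x) phi)) fX0.
by rewrite comp_lfunE tmapE lfunE /= id_lfunE vsprojK // zero_lfunE.
Qed.

End Invariants.

Theorem corollary4p8 (R : realType) (G : groupType)
    (rho sigma : cone_action R G)
    (Hrho : representation rho) (Hsigma : representation sigma)
    (Hsharp : sharp (cone sigma))
    (X : {vspace carrier rho})
    (HX : exists x : carrier rho,
        x \in X /\ interior (cone rho : set (vtop (carrier rho))) x)
    (Psi : 'Hom(subvs_of X, carrier sigma))
    (HPsi : positive_maps
        [set x : subvs_of X | cone rho (vsval x)] (cone sigma) Psi) :
  (exists Phi : 'Hom(carrier rho, carrier sigma),
      [/\ positive_maps (cone rho) (cone sigma) Phi,
          intertwines rho sigma Phi
        & forall x : subvs_of X, Phi (vsval x) = Psi x])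
  <->
  (forall t : tensor (subvs_of X) 'Hom(carrier sigma, R^o),
      Aset (tensor_rep rho (dual_rep sigma))
        (tmap (linfun vsval) \1%VF t) ->
      Aset (tensor_rep sigma (dual_rep sigma)) (tmap Psi \1%VF t)).
Proof.
have [clD cD _ _ _] := Hsigma.
pose i : 'Hom(subvs_of X, carrier rho) := linfun vsval.
split=> [[Phi [Phipos Phii PhiPsi]] t At|AX].
  have -> : Psi = (Phi \o i)%VF.
    by apply/lfunP => x; rewrite comp_lfunE lfunE /= PhiPsi.
  rewrite -[X in tmap _ X](comp_lfun1l \1%VF) -tmap_comp comp_lfunE.
  exact: Aset_intertwiner At.
have [x [Xx Cx]] := HX.
have [ev evE] := evaluation_functional (carrier sigma).
have [evpos evinv] := evaluation_positive_invariant Hsigma evE.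
have [||f Ff|psi psipos|f [fpos finv] fE] := @mem_image_cone _ _ _
  (positive_invariants (tensor_rep rho (dual_rep sigma)))
  (trans (tmap i \1%VF)) (ev \o tmap Psi \1%VF)%VF.
- exact: closed_positive_invariants.
- exact: convex_positive_invariants.
- by rewrite transE; exact: (positive_invariant_eq0 Hsigma Hsharp Xx Cx Ff).
- have [t psiE] := dual_reflexive psi.
  rewrite psiE evalfE comp_lfunE; apply: (AX t _ ev) => // f fpos finv.
  have := psipos f (conj fpos finv).
  by rewrite psiE evalfE transE comp_lfunE.
have [Phi fPhi] := tensor_functional_hom f.
exists Phi; split.
- exact: positive_map_of_functional fpos.
- exact: intertwiner_of_functional finv.
move=> u; apply: functional_separation => phi.
rewrite -fPhi; have := congr1 (fun h : 'Hom(_, _) => h (tens u phi)) fE.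
by rewrite transE !comp_lfunE !tmapE evE lfunE /= id_lfunE.
Qed.
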